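(* Let $r>0$, let $c_2\neq0$ be a real constant, and let $b,c,d$ be continuously differentiable real-valued functions of $t$. The neutral differential equation $$x''(t)+b(t)x'(t-r)+c(t)x(t)+d(t)x(t-r)+k(t)x''(t-r)=0$$ for which $b(t)=0$, $d(t)\neq0$, $k(t)=c_2$ admits the infinitesimal generator given by $$\zeta^*=\Phi_3(t)\frac{\partial}{\partial t}+\Psi_3(t,x)\frac{\partial}{\partial x},$$ where $\Phi_3(t)$ solves $$c_2\,\omega\,\omega_{tt}-c_2\frac{\omega_t^2}{2}+2\omega^2(t)d(t)=c_{16}$$ for $\omega(t)$, and $$\Psi_3(t,x)=\tfrac12\bigl[(\Phi_3(t))_t+c_1\bigr]x+\rho(t).$$ Here $c_1$ and $c_{16}$ are arbitrary constants and $\rho$ is an arbitrary solution of the neutral differential equation itself.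
   Context: Admitted generators. Write $y,q,s$ for $x(t-r),x'(t-r),x''(t-r)$ and $p$ for $x'(t)$, and put $\omega^r=\omega(t-r,y)$, $\Upsilon^r=\Upsilon(t-r,y)$. For functions $\omega(t,x),\Upsilon(t,x)$ (all derivatives below being assumed to exist), the vector field $\zeta^*=\omega\,\partial/\partial t+\Upsilon\,\partial/\partial x$ is an infinitesimal generator admitted by the equation (with $b=0$, $k=c_2$), that is, by $x''(t)+c(t)x(t)+d(t)x(t-r)+c_2x''(t-r)=0$, if the following two conditions hold identically in the independent variables $t,x,p,y,q,s$: (i) $\omega(t-r,y)=\omega(t,x)$ (invariance of the delay relation); (ii) $\Upsilon_{[tt]}+c\,\Upsilon+d\,\Upsilon^r+c_2\,\Upsilon^r_{[tt]}+\omega\,(c'x+d'y)=0$, where $\Upsilon_{[tt]}=\Upsilon_{tt}+(2\Upsilon_{tx}-\omega_{tt})p+(\Upsilon_{xx}-2\omega_{tx})p^2-\omega_{xx}p^3+(\Upsilon_x-2\omega_t)X-3\omega_x pX$ with $X=-(cx+dy+c_2s)$ and derivatives evaluated at $(t,x)$; $\Upsilon^r_{[tt]}=\Upsilon_{tt}+(2\Upsilon_{tx}-\omega_{tt})q+(\Upsilon_{xx}-2\omega_{tx})q^2-\omega_{xx}q^3+(\Upsilon_x-2\omega_t)s-3\omega_xqs$ with derivatives of $\omega,\Upsilon$ evaluated at $(t-r,y)$.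
   Formalization: Not every solution Φ₃ of the ODE gives an admitted generator (c=0, d=c₂=1, Φ₃=sin 2t fails). Proved: every admitted generator has the stated form, and such a field is admitted iff Φ₃ is thrice differentiable, r-periodic and ½Φ₃'''+2cΦ₃'+c'Φ₃=0. *)

(* Defs.v *)
From Stdlib Require Import Reals.
From Coquelicot Require Import Coquelicot.
Open Scope R_scope.

Definition cont_diff (f : R -> R) : Prop :=
  (forall t, ex_derive f t) /\ (forall t, continuous (Derive f) t).

(* [ex_derive_n f n] alone says nothing about the lower-order derivatives
   ([Derive] is total), hence the quantification over all orders up to [n]. *)
Definition times_differentiable (n : nat) (f : R -> R) : Prop :=
  forall m t, (m <= n)%nat -> ex_derive_n f m t.

(* x''(t) + b(t) x'(t-r) + c(t) x(t) + d(t) x(t-r) + k(t) x''(t-r) = 0 *)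
Definition nde_solution (r : R) (b c d k : R -> R) (x : R -> R) : Prop :=
  times_differentiable 2 x /\
  forall t,
    Derive_n x 2 t + b t * Derive x (t - r) + c t * x t + d t * x (t - r)
    + k t * Derive_n x 2 (t - r) = 0.

Definition Dt (f : R -> R -> R) (t x : R) : R := Derive (fun t' => f t' x) t.
Definition Dx (f : R -> R -> R) (t x : R) : R := Derive (fun x' => f t x') x.

(* Existence everywhere of f_t, f_x, f_tt, f_tx = (f_t)_x and f_xx; neither
   continuity nor equality of the two mixed derivatives is required. *)
Definition has_second_partials (f : R -> R -> R) : Prop :=
  forall t x,
    ex_derive (fun t' => f t' x) t /\
    ex_derive (fun x' => f t x') x /\
    ex_derive (fun t' => Dt f t' x) t /\
    ex_derive (fun x' => Dt f t x') x /\
    ex_derive (fun x' => Dx f t x') x.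

(* Coefficient Upsilon_[tt] of the second prolongation of
   omega d/dt + Upsilon d/dx, where p stands for x' and X for x''. *)
Definition prolong2 (omega Upsilon : R -> R -> R) (t x p X : R) : R :=
  Dt (Dt Upsilon) t x
  + (2 * Dx (Dt Upsilon) t x - Dt (Dt omega) t x) * p
  + (Dx (Dx Upsilon) t x - 2 * Dx (Dt omega) t x) * p ^ 2
  - Dx (Dx omega) t x * p ^ 3
  + (Dx Upsilon t x - 2 * Dt omega t x) * X
  - 3 * Dx omega t x * p * X.

(* omega d/dt + Upsilon d/dx is an infinitesimal generator admitted by
   x''(t) + c(t) x(t) + d(t) x(t-r) + c2 x''(t-r) = 0.  The arguments y, q, s
   stand for x(t-r), x'(t-r), x''(t-r), and x''(t) is eliminated by means of
   the equation. *)
Definition admitted (r : R) (c d : R -> R) (c2 : R)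
    (omega Upsilon : R -> R -> R) : Prop :=
  has_second_partials omega /\
  has_second_partials Upsilon /\
  (forall t x y, omega (t - r) y = omega t x) /\
  (forall t x p y q s,
    prolong2 omega Upsilon t x p (- (c t * x + d t * y + c2 * s))
    + c t * Upsilon t x
    + d t * Upsilon (t - r) y
    + c2 * prolong2 omega Upsilon (t - r) y q s
    + omega t x * (Derive c t * x + Derive d t * y) = 0).

(* c2 w w'' - c2 w'^2 / 2 + 2 w^2 d = c16 *)
Definition Phi3_equation (c2 : R) (d : R -> R) (c16 : R) (w : R -> R) : Prop :=
  times_differentiable 2 w /\
  forall t,
    c2 * w t * Derive_n w 2 t - c2 * ((Derive w t) ^ 2 / 2)
    + 2 * (w t) ^ 2 * d t = c16.

Definition Psi3 (Phi3 : R -> R) (c1 : R) (rho : R -> R) (t x : R) : R :=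
  1 / 2 * (Derive Phi3 t + c1) * x + rho t.

(* The determining equations that remain for a vector field of the form
   Phi3 d/dt + Psi3 d/dx once Phi3 solves [Phi3_equation] and rho solves the
   neutral equation: invariance of the delay, and the vanishing of the
   coefficient of x(t).  They do not follow from [Phi3_equation]; for instance
   for c = 0, d = c2 = 1 that equation has the solution sin (2 t), which
   violates the last condition for every r. *)
Definition compatible (r : R) (c : R -> R) (Phi3 : R -> R) : Prop :=
  times_differentiable 3 Phi3 /\
  (forall t, Phi3 (t - r) = Phi3 t) /\
  (forall t,
    1 / 2 * Derive_n Phi3 3 t + 2 * c t * Derive Phi3 t + Derive c t * Phi3 t
    = 0).

(* Main.v *)
(** Invariance of the delay makes [omega] a function [w] of [t] alone, with
    [w (t - r) = w t].  The coefficients of [p] and [s] in the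
    determining equation then force [Upsilon = g t * x + h t] with
    [2 * g' = w''] and [g] of period [r]; the terms free of [x] and [y] say
    that [h] solves the neutral equation, those in [x] give
    [g'' + 2 * c * w' + c' * w = 0], and those in [y] give
    [c2 * g'' + 2 * d * w' + d' * w = 0].  Up to the factor [2 * w], the latter
    is the derivative of the equation for [Phi3].  Dividing by [w] is
    legitimate even though [w] may vanish: if the left-hand side, which is
    continuous, were nonzero at some point, [w] would vanish around this point,
    and so would the left-hand side. *)
From Stdlib Require Import Reals Lra Lia FunctionalExtensionality.
From Coquelicot Require Import Coquelicot.
(* Last, since [Rderiv] also exports a [Dx]. *)
Require Import Defs.
Open Scope R_scope.

(** * One-variable calculus *)

Lemma times_differentiable_2 (f : R -> R) :
  times_differentiable 2 f <->
  (forall t, ex_derive f t) /\ (forall t, ex_derive (Derive f) t).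
Proof.
split.
- intros H; split; intros t; [exact (H 1%nat t ltac:(lia)) | exact (H 2%nat t ltac:(lia))].
- intros [H1 H2] [|[|[|m]]] t Hm; [exact I | exact (H1 t) | exact (H2 t) | lia].
Qed.

Lemma times_differentiable_3 (f : R -> R) :
  times_differentiable 3 f <->
  times_differentiable 2 f /\ (forall t, ex_derive (Derive_n f 2) t).
Proof.
split.
- intros H; split.
  + intros m t Hm; apply H; lia.
  + intros t; exact (H 3%nat t ltac:(lia)).
- intros [H2 H3] m t Hm.
  destruct (Nat.eq_dec m 3) as [-> | Hne]; [exact (H3 t) | apply H2; lia].
Qed.

Lemma ex_derive_affine_iff (a : R) (f : R -> R) (k t : R) :
  a <> 0 -> ex_derive (fun u => a * (f u + k)) t <-> ex_derive f t.
Proof.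
intros Ha; split; intros H.
- apply ex_derive_ext with (fun u => / a * (a * (f u + k)) - k).
  + intros u; simpl; field; exact Ha.
  + apply (ex_derive_minus (V := R_NormedModule)).
    * apply ex_derive_scal, H.
    * apply ex_derive_const.
- auto_derive; exact H.
Qed.

(** The constant [k] cancels in every difference quotient, so differentiability of [f] is not at
    stake: both sides agree even where [Derive] takes a default value. *)
Lemma Derive_affine (a : R) (f : R -> R) (k t : R) :
  Derive (fun u => a * (f u + k)) t = a * Derive f t.
Proof.
rewrite Derive_scal.
f_equal; unfold Derive; f_equal; apply Lim_ext; intros y.
f_equal; ring.
Qed.

(** The difference quotients at [t - r] and at [t] coincide term by term, so their limits do,
    whether or not [f] is differentiable. *)
Lemma Derive_translation (f : R -> R) (r : R) :
  (forall t, f (t - r) = f t) -> forall t, Derive f (t - r) = Derive f t.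
Proof.
intros H t; unfold Derive; f_equal; apply Lim_ext; intros y.
rewrite <- (H t), <- (H (t + y)).
replace (t + y - r) with (t - r + y) by ring; reflexivity.
Qed.

Lemma Derive_zero_const (f : R -> R) :
  (forall t, is_derive f t 0) -> forall t, f t = f 0.
Proof.
intros H t.
destruct (MVT_gen f 0 t (fun _ => 0)) as [u [_ Hu]].
- intros; apply H.
- intros u _; apply continuity_pt_filterlim.
  apply (ex_derive_continuous (V := R_NormedModule)); exists 0; apply H.
- lra.
Qed.

(** * Partial derivatives and prolongation for coefficients affine in [x] *)

Lemma is_derive_affine_x (a b x : R) : is_derive (fun u => a * u + b) x a.
Proof. auto_derive; [exact I | ring]. Qed.

Lemma ex_derive_affine_coef (g h : R -> R) (t : R) :
  (forall x, ex_derive (fun u => g u * x + h u) t) <->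
  ex_derive g t /\ ex_derive h t.
Proof.
split.
- intros H; split.
  (* [g] is the difference of the values at [x = 1] and [x = 0], and [h] is the value at [x = 0]. *)
  + apply ex_derive_ext with (fun u => (g u * 1 + h u) - (g u * 0 + h u)).
    * intros u; simpl; ring.
    * apply (ex_derive_minus (V := R_NormedModule)); apply H.
  + apply ex_derive_ext with (fun u => g u * 0 + h u); [intros u; simpl; ring | apply H].
- intros [Hg Hh] x; auto_derive; auto.
Qed.

Lemma Derive_affine_coef (g h : R -> R) (x t : R) :
  ex_derive g t -> ex_derive h t ->
  Derive (fun u => g u * x + h u) t = Derive g t * x + Derive h t.
Proof.
intros Hg Hh; apply is_derive_unique; auto_derive; [auto | ].
change (fun x0 : R => g x0) with g; change (fun x0 : R => h x0) with h; ring.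
Qed.

Lemma Dt_affine (g h : R -> R) :
  (forall t, ex_derive g t) -> (forall t, ex_derive h t) ->
  Dt (fun t x => g t * x + h t) = fun t x => Derive g t * x + Derive h t.
Proof.
intros Hg Hh.
apply functional_extensionality; intros t; apply functional_extensionality; intros x.
apply Derive_affine_coef; auto.
Qed.

Lemma Dx_affine (g h : R -> R) : Dx (fun t x => g t * x + h t) = fun t _ => g t.
Proof.
apply functional_extensionality; intros t; apply functional_extensionality; intros x.
apply is_derive_unique, is_derive_affine_x.
Qed.

Lemma Dx_time_only (w : R -> R) : Dx (fun t _ => w t) = fun _ _ => 0.
Proof.
apply functional_extensionality; intros t; apply functional_extensionality; intros x.
exact (Derive_const (w t) x).
Qed.

Lemma Dt_time_only (w : R -> R) : Dt (fun t _ => w t) = fun t _ => Derive w t.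
Proof. reflexivity. Qed.

Lemma has_second_partials_time_only (w : R -> R) :
  has_second_partials (fun t _ => w t) <-> times_differentiable 2 w.
Proof.
rewrite times_differentiable_2; unfold has_second_partials.
rewrite Dx_time_only, Dt_time_only.
split.
- intros H; split; intros t; apply (H t 0).
- intros [H1 H2] t x; repeat split; auto; apply ex_derive_const.
Qed.

Lemma has_second_partials_affine (g h : R -> R) :
  has_second_partials (fun t x => g t * x + h t) <->
  times_differentiable 2 g /\ times_differentiable 2 h.
Proof.
rewrite !times_differentiable_2; unfold has_second_partials; rewrite Dx_affine.
split.
- intros H.
  (* The first partials come first: [Dt] can be computed by [Dt_affine], and the second partials
     read off, only once [g] and [h] are differentiable. *)
  assert (H1 : forall t, ex_derive g t /\ ex_derive h t)
    by (intros t; apply ex_derive_affine_coef; intros x; apply (H t x)).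
  rewrite Dt_affine in H by (intros t; apply (H1 t)).
  assert (H2 : forall t, ex_derive (Derive g) t /\ ex_derive (Derive h) t)
    by (intros t; apply ex_derive_affine_coef; intros x; apply (H t x)).
  repeat split; intros t; first [apply (H1 t) | apply (H2 t)].
- intros [[Hg1 Hg2] [Hh1 Hh2]] t x; rewrite Dt_affine by assumption.
  repeat split.
  + apply ex_derive_affine_coef; auto.
  + eexists; apply is_derive_affine_x.
  + apply ex_derive_affine_coef; auto.
  + eexists; apply is_derive_affine_x.
  + apply ex_derive_const.
Qed.

(** [U] stays arbitrary here because this form serves to prove that [U] is affine in [x]. *)
Lemma prolong2_time_only (w : R -> R) (U : R -> R -> R) (t x p X : R) :
  prolong2 (fun t _ => w t) U t x p X =
  Dt (Dt U) t x + (2 * Dx (Dt U) t x - Derive_n w 2 t) * p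
  + Dx (Dx U) t x * p ^ 2 + (Dx U t x - 2 * Derive w t) * X.
Proof.
unfold prolong2.
rewrite !Dt_time_only, !Dx_time_only.
change (Derive_n w 2 t) with (Derive (Derive w) t); ring.
Qed.

Lemma prolong2_affine (w g h : R -> R) (t x p X : R) :
  times_differentiable 2 g -> times_differentiable 2 h ->
  prolong2 (fun t _ => w t) (fun t x => g t * x + h t) t x p X =
  Derive_n g 2 t * x + Derive_n h 2 t
  + (2 * Derive g t - Derive_n w 2 t) * p + (g t - 2 * Derive w t) * X.
Proof.
rewrite !times_differentiable_2; intros [Hg1 Hg2] [Hh1 Hh2].
rewrite prolong2_time_only, Dx_affine, Dx_time_only, !Dt_affine, Dx_affine by assumption.
change (Derive_n g 2 t) with (Derive (Derive g) t).
change (Derive_n h 2 t) with (Derive (Derive h) t); ring.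
Qed.

(** * Determining equations *)

Lemma admitted_affine (r c2 : R) (c d w g h : R -> R) :
  c2 <> 0 ->
  admitted r c d c2 (fun t _ => w t) (fun t x => g t * x + h t) <->
  (times_differentiable 2 w /\ times_differentiable 2 g /\ times_differentiable 2 h) /\
  (forall t, w (t - r) = w t) /\
  (forall t, g (t - r) = g t) /\
  (forall t, 2 * Derive g t = Derive_n w 2 t) /\
  (forall t, Derive_n h 2 t + c t * h t + d t * h (t - r) + c2 * Derive_n h 2 (t - r) = 0) /\
  (forall t, Derive_n g 2 t + 2 * c t * Derive w t + Derive c t * w t = 0) /\
  (forall t, c2 * Derive_n g 2 t + 2 * d t * Derive w t + Derive d t * w t = 0).
Proof.
intros hc2; unfold admitted.
rewrite has_second_partials_time_only, has_second_partials_affine.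
split.
- intros [Hw [[Hg Hh] [Hper Heq]]].
  assert (Hwr : forall t, w (t - r) = w t) by (intros t; exact (Hper t 0 0)).
  assert (Hw'r := Derive_translation w r Hwr).
  (* For fixed [t] the left-hand side is affine in [(x, p, y, q, s)]. Its value at the origin is the
     equation for [h]; subtracting that value from the one at a unit vector isolates a single
     coefficient. *)
  assert (E : forall t x p y q s,
    Derive_n g 2 t * x + Derive_n h 2 t + (2 * Derive g t - Derive_n w 2 t) * p
    + (g t - 2 * Derive w t) * - (c t * x + d t * y + c2 * s)
    + c t * (g t * x + h t) + d t * (g (t - r) * y + h (t - r))
    + c2 * (Derive_n g 2 (t - r) * y + Derive_n h 2 (t - r)
            + (2 * Derive g (t - r) - Derive_n w 2 (t - r)) * q
            + (g (t - r) - 2 * Derive w (t - r)) * s)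
    + w t * (Derive c t * x + Derive d t * y) = 0).
  { intros t x p y q s; rewrite <- (Heq t x p y q s).
    rewrite !prolong2_affine by assumption; reflexivity. }
  assert (Hgr : forall t, g (t - r) = g t).
  (* The coefficient of [s] is [c2 * (g (t - r) - g t)], since the terms in [w'] cancel by
     periodicity. *)
  { intros t; apply (Rmult_eq_reg_l c2); [ | exact hc2].
    generalize (E t 0 0 0 0 1) (E t 0 0 0 0 0); rewrite Hw'r; lra. }
  assert (Hg2r : forall t, Derive_n g 2 (t - r) = Derive_n g 2 t)
    by (intros t; apply (Derive_translation (Derive g)), Derive_translation, Hgr).
  repeat split; try assumption.
  + intros t; generalize (E t 0 1 0 0 0) (E t 0 0 0 0 0); lra.
  + intros t; generalize (E t 0 0 0 0 0); lra.
  + intros t; generalize (E t 1 0 0 0 0) (E t 0 0 0 0 0); lra.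
  + intros t; generalize (E t 0 0 1 0 0) (E t 0 0 0 0 0).
    rewrite Hg2r, Hgr; lra.
- intros [[Hw [Hg Hh]] [Hwr [Hgr [Hp [H0 [Hx Hy]]]]]].
  repeat split; try assumption; [intros t _ _; apply Hwr | ].
  intros t x p y q s; rewrite !prolong2_affine by assumption.
  (* Used at [t] and at [t - r], [Hp] removes the terms in [p] and in [q]. *)
  rewrite (Derive_translation w r Hwr), Hgr, !Hp.
  replace (Derive_n g 2 (t - r)) with (Derive_n g 2 t)
    by (symmetry; apply (Derive_translation (Derive g)), Derive_translation, Hgr).
  transitivity
    ((Derive_n h 2 t + c t * h t + d t * h (t - r) + c2 * Derive_n h 2 (t - r))
     + x * (Derive_n g 2 t + 2 * c t * Derive w t + Derive c t * w t)
     + y * (c2 * Derive_n g 2 t + 2 * d t * Derive w t + Derive d t * w t)).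
  + ring.
  + rewrite H0, Hx, Hy; ring.
Qed.

(** In the invariance of the delay, [x] and [y] are independent, so neither side can depend on its
    own space variable. *)
Lemma admitted_time_only (r c2 : R) (c d : R -> R) (omega U : R -> R -> R) :
  admitted r c d c2 omega U -> omega = fun t _ => omega t 0.
Proof.
intros [_ [_ [Hper _]]].
apply functional_extensionality; intros t; apply functional_extensionality; intros x.
rewrite <- (Hper t x 0); apply Hper.
Qed.

(** The coefficient of [s] equates [Dx U (t - r) y] with [Dx U t x] for independent [x] and [y], so
    [Dx U t] is constant in [x], and integration in [x] gives the affine form. *)
Lemma admitted_affine_form (r c2 : R) (c d w : R -> R) (U : R -> R -> R) :
  c2 <> 0 -> admitted r c d c2 (fun t _ => w t) U ->
  U = fun t x => Dx U t 0 * x + U t 0.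
Proof.
intros hc2 [_ [HU [Hper E]]].
assert (Hw'r := Derive_translation w r (fun t => Hper t 0 0)).
setoid_rewrite prolong2_time_only in E.
assert (HDx : forall t x, Dx U t x = Dx U t 0).
{ assert (K : forall t x, Dx U (t - r) 0 = Dx U t x).
  { intros t x; apply (Rmult_eq_reg_l c2); [ | exact hc2].
    generalize (E t x 0 0 0 1) (E t x 0 0 0 0); rewrite Hw'r; lra. }
  intros t x; rewrite <- (K t x); apply K. }
apply functional_extensionality; intros t; apply functional_extensionality; intros x.
set (g := Dx U t 0).
assert (Hc : forall u, is_derive (fun u => U t u - g * u) u 0).
{ intros u.
  replace 0 with (Dx U t u - g * 1) by (unfold g; rewrite HDx; ring).
  apply (is_derive_minus (V := R_NormedModule)).
  - apply Derive_correct; exact (proj1 (proj2 (HU t u))).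
  - apply is_derive_scal; apply (is_derive_id (K := R_AbsRing)). }
generalize (Derive_zero_const _ Hc x); cbv beta; lra.
Qed.

(** * The equation for [Phi3] and its derivative *)

Lemma is_derive_Phi3_lhs (c2 : R) (d w : R -> R) (t : R) :
  ex_derive d t -> times_differentiable 3 w ->
  is_derive
    (fun t => c2 * w t * Derive_n w 2 t - c2 * ((Derive w t) ^ 2 / 2) + 2 * (w t) ^ 2 * d t) t
    (2 * w t * (c2 / 2 * Derive_n w 3 t + 2 * d t * Derive w t + Derive d t * w t)).
Proof.
intros Hd Hw.
assert (H0 : is_derive w t (Derive w t)) by (apply Derive_correct, (Hw 1%nat); lia).
assert (H1 : is_derive (Derive w) t (Derive_n w 2 t))
  by (apply Derive_correct, (Hw 2%nat); lia).
assert (H2 : is_derive (Derive_n w 2) t (Derive_n w 3 t))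
  by (apply Derive_correct, (Hw 3%nat); lia).
assert (Hd1 := Derive_correct _ _ Hd).
(* The derivatives of [w] become opaque functions, known only through [is_derive], so that
   [auto_derive] treats them as atoms. *)
generalize dependent (Derive_n w 3 t); intros w3 H2.
revert H1 H2; generalize (Derive_n w 2); intros w2 H1 H2.
revert H0 H1; generalize (Derive w); intros w1 H0 H1.
generalize dependent (Derive d t); intros d1 Hd1.
auto_derive.
- repeat split; eexists; eassumption.
- change (Derive (fun x : R => w x) t) with (Derive w t).
  change (Derive (fun x : R => w1 x) t) with (Derive w1 t).
  change (Derive (fun x : R => w2 x) t) with (Derive w2 t).
  change (Derive (fun x : R => d x) t) with (Derive d t).
  rewrite (is_derive_unique _ _ _ H0), (is_derive_unique _ _ _ H1),
    (is_derive_unique _ _ _ H2), (is_derive_unique _ _ _ Hd1).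
  (* The two terms [c2 * w' * w''] cancel, which leaves the common factor [2 * w]. *)
  field.
Qed.

Lemma locally_zero_Derive_n (f : R -> R) (n : nat) (t : R) :
  locally t (fun u => f u = 0) -> Derive_n f n t = 0.
Proof.
intros H; rewrite (Derive_n_ext_loc f (fun _ => 0)) by exact H.
destruct n; [reflexivity | exact (Derive_n_const n 0 t)].
Qed.

Lemma Phi3_equation_derived (c2 c16 : R) (c d w : R -> R) :
  cont_diff c -> cont_diff d ->
  Phi3_equation c2 d c16 w -> times_differentiable 3 w ->
  (forall t, 1 / 2 * Derive_n w 3 t + 2 * c t * Derive w t + Derive c t * w t = 0) ->
  forall t, c2 / 2 * Derive_n w 3 t + 2 * d t * Derive w t + Derive d t * w t = 0.
Proof.
intros [Hc Hc'] [Hd Hd'] [_ HPhi] Hw Hx.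
set (F := fun t => c2 / 2 * Derive_n w 3 t + 2 * d t * Derive w t + Derive d t * w t).
assert (HwF : forall t, w t * F t = 0).
{ intros t.
  generalize (is_derive_unique _ _ _ (is_derive_Phi3_lhs c2 d w t (Hd t) Hw)).
  rewrite (Derive_ext _ (fun _ => c16)) by exact HPhi.
  rewrite Derive_const; unfold F; lra. }
assert (Hcont : forall t, continuous F t).
{ intros t.
  (* The third derivative of [w] is not assumed continuous; the equation [Hx] expresses it through
     [w], [w'], [c] and [c'], which are. *)
  apply continuous_ext with
    (fun t => (2 * d t - 2 * c2 * c t) * Derive w t + (Derive d t - c2 * Derive c t) * w t).
  { intros u; unfold F.
    (* The equality is restated at type [R], where [field] recognises it. *)
    match goal with |- ?a = ?b => change (@eq R a b) end.
    replace (Derive_n w 3 u) with (- 2 * (2 * c u * Derive w u + Derive c u * w u))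
      by (generalize (Hx u); lra).
    field. }
  assert (Cw : continuous w t)
    by (apply (ex_derive_continuous (V := R_NormedModule)), (Hw 1%nat); lia).
  assert (Cw' : continuous (Derive w) t)
    by (apply (ex_derive_continuous (V := R_NormedModule)), (Hw 2%nat); lia).
  assert (Cc := ex_derive_continuous (V := R_NormedModule) _ _ (Hc t)).
  assert (Cd := ex_derive_continuous (V := R_NormedModule) _ _ (Hd t)).
  assert (Cs : forall (a : R) (f : R -> R), continuous f t -> continuous (fun u => a * f u) t)
    by (intros a f Cf; exact (continuous_scal_r (V := R_NormedModule) a f t Cf)).
  apply (continuous_plus (V := R_NormedModule));
    apply (continuous_mult (K := R_AbsRing)); try assumption;
    apply (continuous_minus (V := R_NormedModule)); auto. }
intros t; fold (F t).
destruct (Req_dec (F t) 0) as [ | HF]; [assumption | exfalso].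
assert (Hw0 : locally t (fun u => w u = 0)).
{ apply filter_imp with (fun u => F u <> 0).
  - intros u HFu; destruct (Rmult_integral _ _ (HwF u)); [assumption | contradiction].
  - apply (Hcont t (fun z => z <> 0)), open_neq, HF. }
apply HF; unfold F.
rewrite (locally_zero_Derive_n w 3 t Hw0), (locally_singleton _ _ Hw0).
change (Derive w t) with (Derive_n w 1 t); rewrite (locally_zero_Derive_n w 1 t Hw0); ring.
Qed.

(** * The coefficient of [x] in [Psi3] *)

Lemma times_differentiable_Psi3_slope (w : R -> R) (c1 : R) :
  times_differentiable 2 w ->
  (times_differentiable 2 (fun t => 1 / 2 * (Derive w t + c1)) <-> times_differentiable 3 w).
Proof.
intros Hw; rewrite times_differentiable_3, (times_differentiable_2 (fun t => _)).
(* The summand [0] gives the derivative the shape required by [ex_derive_affine_iff]. *)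
assert (H2 : Derive (fun t => 1 / 2 * (Derive w t + c1)) = fun t => 1 / 2 * (Derive_n w 2 t + 0)).
{ apply functional_extensionality; intros t; rewrite Derive_affine.
  change (Derive_n w 2 t) with (Derive (Derive w) t); ring. }
rewrite H2; split.
- intros [_ H]; split; [exact Hw | intros t].
  apply (ex_derive_affine_iff (1 / 2) (Derive_n w 2) 0 t); [lra | apply H].
- intros [_ H]; split; intros t; apply ex_derive_affine_iff; try lra.
  + apply times_differentiable_2; exact Hw.
  + apply H.
Qed.

Lemma Derive_Psi3_slope (w : R -> R) (c1 t : R) :
  Derive (fun t => 1 / 2 * (Derive w t + c1)) t = 1 / 2 * Derive_n w 2 t.
Proof. exact (Derive_affine (1 / 2) (Derive w) c1 t). Qed.

Lemma Derive_n_2_Psi3_slope (w : R -> R) (c1 t : R) :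
  Derive_n (fun t => 1 / 2 * (Derive w t + c1)) 2 t = 1 / 2 * Derive_n w 3 t.
Proof.
change (Derive (Derive (fun t => 1 / 2 * (Derive w t + c1))) t = 1 / 2 * Derive (Derive_n w 2) t).
rewrite (Derive_ext _ _ t (Derive_Psi3_slope w c1)); apply Derive_scal.
Qed.

Theorem theorem3p8 (r c2 : R) (b c d k : R -> R)
  (hr : 0 < r) (hc2 : c2 <> 0)
  (hb : cont_diff b) (hc : cont_diff c) (hd : cont_diff d)
  (hb0 : forall t, b t = 0)
  (hd0 : forall t, d t <> 0)
  (hk : forall t, k t = c2) :
  (forall omega Upsilon : R -> R -> R,
     admitted r c d c2 omega Upsilon ->
     exists (c1 c16 : R) (Phi3 rho : R -> R),
       Phi3_equation c2 d c16 Phi3 /\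
       nde_solution r b c d k rho /\
       (forall t x, omega t x = Phi3 t) /\
       (forall t x, Upsilon t x = Psi3 Phi3 c1 rho t x))
  /\
  (forall (c1 c16 : R) (Phi3 rho : R -> R),
     Phi3_equation c2 d c16 Phi3 ->
     nde_solution r b c d k rho ->
     (admitted r c d c2 (fun t _ => Phi3 t) (Psi3 Phi3 c1 rho)
      <-> compatible r c Phi3)).
Proof.
assert (Hnde : forall rho, nde_solution r b c d k rho <->
  times_differentiable 2 rho /\
  forall t, Derive_n rho 2 t + c t * rho t + d t * rho (t - r) + c2 * Derive_n rho 2 (t - r) = 0).
{ intros rho; unfold nde_solution.
  split; (intros [H2 H]; split; [exact H2 | intros t]); generalize (H t);
    rewrite hb0, hk; lra. }
split.
- intros omega Upsilon Hadm.
  assert (Homega := admitted_time_only _ _ _ _ _ _ Hadm).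
  set (w := fun t => omega t 0).
  (* Forgetting that [w] was defined from [omega] makes the equation non-circular, so that [subst]
     applies; the same is done below for [Upsilon]. *)
  change (omega = fun t _ => w t) in Homega; clearbody w; subst omega.
  assert (HU := admitted_affine_form _ _ _ _ _ _ hc2 Hadm).
  set (g := fun t => Dx Upsilon t 0); set (rho := fun t => Upsilon t 0).
  change (Upsilon = fun t x => g t * x + rho t) in HU.
  clearbody g rho; subst Upsilon.
  apply (admitted_affine _ _ _ _ _ _ _ hc2) in Hadm.
  destruct Hadm as [[Hw [Hg Hrho]] [Hwr [Hgr [Hp [H0 [Hx Hy]]]]]].
  assert (Hg1 := proj1 (proj1 (times_differentiable_2 g) Hg)).
  assert (Hw2 := proj2 (proj1 (times_differentiable_2 w) Hw)).
  (* By [Hp] the function [2 * g - w'] has derivative zero; [c1] is its constant value. *)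
  set (c1 := 2 * g 0 - Derive w 0).
  assert (Hslope : g = fun t => 1 / 2 * (Derive w t + c1)).
  { apply functional_extensionality; intros t.
    assert (Hc : forall u, is_derive (fun u => 2 * g u - Derive w u) u 0).
    { intros u; replace 0 with (2 * Derive g u - Derive (Derive w) u)
        by (rewrite Hp; change (Derive_n w 2 u) with (Derive (Derive w) u); ring).
      apply (is_derive_minus (V := R_NormedModule)).
      - apply is_derive_scal, Derive_correct, Hg1.
      - apply Derive_correct, Hw2. }
    generalize (Derive_zero_const _ Hc t); unfold c1; cbv beta; lra. }
  clearbody c1; subst g.
  apply times_differentiable_Psi3_slope in Hg; [ | exact Hw].
  (* The constant [c16] will be [L 0]: the derivative of [L] is [2 * w] times the left-hand side of
     the [y] equation [Hy], hence zero. *)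
  set (L := fun t =>
    c2 * w t * Derive_n w 2 t - c2 * ((Derive w t) ^ 2 / 2) + 2 * (w t) ^ 2 * d t).
  exists c1, (L 0), w, rho; repeat split.
  + exact Hw.
  + apply (Derive_zero_const L); intros t.
    replace 0 with
      (2 * w t * (c2 / 2 * Derive_n w 3 t + 2 * d t * Derive w t + Derive d t * w t)).
    * apply is_derive_Phi3_lhs; [apply hd | exact Hg].
    * generalize (Hy t); rewrite Derive_n_2_Psi3_slope; intros E.
      replace (c2 / 2 * Derive_n w 3 t + 2 * d t * Derive w t + Derive d t * w t) with 0
        by lra; ring.
  + exact Hrho.
  + apply Hnde; auto.
- intros c1 c16 w rho HPhi Hrho.
  apply Hnde in Hrho; destruct Hrho as [Hrho H0].
  assert (Hw := proj1 HPhi).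
  (* The unreduced application exhibits the function [g] of [admitted_affine]. *)
  change (Psi3 w c1 rho) with (fun t x => (fun t => 1 / 2 * (Derive w t + c1)) t * x + rho t).
  rewrite (admitted_affine _ _ _ _ _ _ _ hc2), (times_differentiable_Psi3_slope w c1 Hw).
  unfold compatible; split.
  + intros [[_ [Hw3 _]] [Hwr [_ [_ [_ [Hx _]]]]]]; repeat split; try assumption.
    intros t; rewrite <- Derive_n_2_Psi3_slope with (c1 := c1); apply Hx.
  + intros [Hw3 [Hwr Hx]]; repeat split; try assumption; intros t.
    * rewrite (Derive_translation w r Hwr); reflexivity.
    * rewrite Derive_Psi3_slope; field.
    * rewrite Derive_n_2_Psi3_slope; apply Hx.
    (* The [y] equation is the one condition that uses the equation for [Phi3], differentiated and
       divided by [2 * w]. *)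
    * rewrite Derive_n_2_Psi3_slope.
      rewrite <- (Phi3_equation_derived c2 c16 c d w hc hd HPhi Hw3 Hx t); field.
Qed.
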